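(* Let $\varepsilon>0$ be a constant, let $0\le \ell\le 1-\varepsilon$ and $\delta\in(0,1]$. Let $f:\mathbb{F}_2^n\to\{-1,1\}$ be a Boolean function that is $(\delta,\ell)$-folding and whose Fourier sparsity $k$ is sufficiently large (in terms of $\varepsilon,\delta$). Set $p:=\frac{4000\log k}{\delta k^{(1+\ell)/2}}$ and let $\mathcal{R}$ be the random subset of $\mathcal{S}$ returned by $\textsc{SampleParity}(f,p)$. Then with probability at least $1-\frac1k$, \[ \mathcal{B}(f,\mathsf{span}\,\mathcal{R})\le k-\frac{\delta k}{6}. \]
   Context: Logarithms are base 2. For $\alpha\in\mathbb{F}_2^n$ let $\chi_\alpha(x)=(-1)^{\sum_i\alpha_ix_i}$; every $f:\mathbb{F}_2^n\to\mathbb{R}$ is uniquely $f=\sum_\alpha\widehat f(\alpha)\chi_\alpha$. The Fourier support is $\mathcal{S}=\{\alpha:\widehat f(\alpha)\ne0\}$ and $k=|\mathcal{S}|$. For $\gamma\in\mathbb{F}_2^n$, $O_\gamma$ is the set of unordered pairs $\{\alpha,\beta\}$ of distinct elements of $\mathcal{S}$ with $\alpha+\beta=\gamma$. $f$ is $(\delta,\ell)$-folding if the number of unordered pairs $\{\alpha,\beta\}$ of distinct elements of $\mathcal{S}$ with $|O_{\alpha+\beta}|\ge k^\ell+1$ is at least $\delta\binom{k}{2}$. $\textsc{SampleParity}(f,p)$ returns a random $\mathcal{R}\subseteq\mathcal{S}$ containing each $\alpha\in\mathcal{S}$ independently with probability $p$. $\mathsf{span}\,\Gamma$ is the $\mathbb{F}_2$-linear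 span of $\Gamma$. For a linear subspace $\mathcal{G}$, $\mathcal{B}(f,\mathcal{G})$ is the number of cosets of $\mathcal{G}$ that intersect $\mathcal{S}$. *)

(* Defs.v *)
From HB Require Import structures.
From mathcomp Require Import all_boot all_order all_algebra.
From mathcomp Require Import reals exp.

Set Implicit Arguments.
Unset Strict Implicit.
Unset Printing Implicit Defensive.

Import Order.TTheory GRing.Theory Num.Theory.
Local Open Scope ring_scope.

Notation cube n := 'rV['F_2]_n.

Definition log2 (R : realType) (x : R) : R := ln x / ln 2.

Section Fourier.
Variables (R : realType) (n : nat).
Implicit Types (f : cube n -> R) (alpha beta gamma x : cube n).

Definition character alpha x : R :=
  (-1) ^+ (\sum_(i < n) (alpha ord0 i : nat) * (x ord0 i : nat))%N.

(* The coefficient is given by the orthogonality formula; fourier_expansion and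
   fourier_unique show that it is the one of the unique character expansion. *)
Definition fourier f alpha : R :=
  (2 ^+ n)^-1 * \sum_(x : cube n) f x * character alpha x.

Lemma characterD alpha beta x :
  character (alpha + beta) x = character alpha x * character beta x.
Proof.
rewrite /character -!prodrXr -big_split /=; apply: eq_bigr => i _.
rewrite mxE.
by case: (alpha ord0 i) => [[|[|//]] ?]; case: (beta ord0 i) => [[|[|//]] ?];
   case: (x ord0 i) => [[|[|//]] ?];
   rewrite /= ?(mul0n, muln0, mul1n, muln1) ?expr0 ?expr1 ?mulr1 ?mul1r ?mulrNN
     ?mulr1.
Qed.

Lemma characterC alpha x : character alpha x = character x alpha.
Proof. by rewrite /character; under eq_bigr do rewrite mulnC. Qed.

Lemma sum_character alpha :
  \sum_(x : cube n) character alpha x = if alpha == 0 then 2 ^+ n else 0.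
Proof.
case: eqVneq => [->|].
  rewrite (eq_bigr (fun=> 1)) => [|x _].
    by rewrite sumr_const card_mx card_Fp // mul1n -natrX.
  by rewrite /character big1 ?expr0 // => i _; rewrite mxE mul0n.
case/rV0Pn => i ai.
have ca : character alpha (delta_mx ord0 i) = -1.
  rewrite /character (bigD1 i) //= big1 ?addn0 => [|j ji].
    rewrite mxE !eqxx /=.
    by case: (alpha ord0 i) ai => [[|[|//]] ?] //= _; rewrite expr1.
  by rewrite mxE eqxx (negPf ji) muln0.
set s := \sum_x _.
suff : s = - s by move/eqP; rewrite eq_sym eqNr => /eqP.
rewrite {1}/s (reindex_inj (addrI (delta_mx ord0 i))) /=.
rewrite -mulN1r -ca mulr_sumr; apply: eq_bigr => x _.
by rewrite !(characterC alpha) characterD.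
Qed.

Lemma cube_oppr alpha : - alpha = alpha.
Proof.
apply/rowP => i; rewrite !mxE.
by case: (alpha ord0 i) => [[|[|//]] ?]; apply/val_inj.
Qed.

Lemma sum_characterM alpha beta :
  \sum_(x : cube n) character alpha x * character beta x =
  if alpha == beta then 2 ^+ n else 0.
Proof.
under eq_bigr do rewrite -characterD.
by rewrite sum_character -[beta in LHS]cube_oppr subr_eq0.
Qed.

Theorem fourier_expansion f x :
  f x = \sum_(alpha : cube n) fourier f alpha * character alpha x.
Proof.
have two0 : 2 ^+ n != 0 :> R by rewrite expf_neq0 ?pnatr_eq0.
under eq_bigr do rewrite /fourier -mulrA mulr_suml.
rewrite -mulr_sumr exchange_big /=.
under eq_bigr => y _.
  under eq_bigr do rewrite -mulrA !(characterC _ y) !(characterC _ x).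
  rewrite -mulr_sumr sum_characterM; over.
rewrite (bigD1 x) //= eqxx big1 ?addr0 => [|y /negPf ->]; last by rewrite mulr0.
by rewrite mulrCA mulVf ?mulr1.
Qed.

Theorem fourier_unique f (c : cube n -> R) :
  (forall x, f x = \sum_(alpha : cube n) c alpha * character alpha x) ->
  forall alpha, c alpha = fourier f alpha.
Proof.
move=> fE alpha; rewrite /fourier.
have two0 : 2 ^+ n != 0 :> R by rewrite expf_neq0 ?pnatr_eq0.
under eq_bigr do rewrite fE mulr_suml.
rewrite exchange_big /=.
under eq_bigr => beta _.
  under eq_bigr do rewrite -mulrA.
  rewrite -mulr_sumr sum_characterM; over.
rewrite (bigD1 alpha) //= eqxx big1 ?addr0 => [|y /negPf ->]; last first.
  by rewrite mulr0.
by rewrite mulrCA mulVf ?mulr1.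
Qed.

Definition fourier_support f : {set cube n} := [set alpha | fourier f alpha != 0].

Definition sparsity f : nat := #|fourier_support f|.

(* Unordered pairs are encoded as two-element sets. *)
Definition support_pairs f gamma : {set {set cube n}} :=
  [set [set alpha; beta] | alpha in fourier_support f, beta in fourier_support f
     & (alpha != beta) && (alpha + beta == gamma)].

Definition folding_pairs f (l : R) : {set {set cube n}} :=
  [set [set alpha; beta] | alpha in fourier_support f, beta in fourier_support f
     & (alpha != beta) &&
       ((sparsity f)%:R `^ l + 1 <= #|support_pairs f (alpha + beta)|%:R)].

Definition folding f (delta l : R) : Prop :=
  delta * 'C(sparsity f, 2)%:R <= #|folding_pairs f l|%:R.

(* Product Bernoulli weights on the subsets of the support, a probability mass
   function when 0 <= p <= 1; sample_parity_prob_supset expresses that every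
   element of the support is included independently with probability p. *)
Definition sample_parity_pmf f (p : R) (A : {set cube n}) : R :=
  if A \subset fourier_support f
  then \prod_(alpha in fourier_support f) (if alpha \in A then p else 1 - p)
  else 0.

Definition sample_parity_prob f (p : R) (E : {pred {set cube n}}) : R :=
  \sum_(A : {set cube n} | A \in E) sample_parity_pmf f p A.

Theorem sample_parity_prob_supset f (p : R) (B : {set cube n}) :
  B \subset fourier_support f ->
  sample_parity_prob f p [pred A : {set cube n} | B \subset A] = p ^+ #|B|.
Proof.
move=> BS; set S := fourier_support f.
pose F (i : cube n) : R := if i \in S then p else 0.
pose G (i : cube n) : R := if i \in B then 0 else if i \in S then 1 - p else 1.
transitivity (\prod_i (F i + G i)); last first.
  rewrite (bigID (mem B)) /= [X in _ * X]big1 ?mulr1 => [|i /negPf iB].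
    rewrite -prodr_const; apply: eq_bigr => i iB.
    by rewrite /F /G iB (subsetP BS) // addr0.
  by rewrite /F /G iB; case: ifP => _; rewrite ?add0r // subrKC.
rewrite bigA_distr /sample_parity_prob big_mkcond /=.
apply: eq_bigr => A _; rewrite inE.
case: ifPn => [BA|/subsetPn [i iB /negPf iA]]; last first.
  by rewrite (bigD1 i) //= iA /G iB mul0r.
rewrite /sample_parity_pmf; case: ifPn => [AS|/subsetPn [i iA /negPf iS]]; last first.
  by rewrite (bigD1 i) //= iA /F iS mul0r.
rewrite big_mkcond /=; apply: eq_bigr => i _; rewrite /F /G -/S.
have [iS|iS] := boolP (i \in S).
  case: ifPn => // iA; case: ifPn => // /(subsetP BA).
  by rewrite (negPf iA).
case: ifPn => [/(subsetP AS)|iA]; first by rewrite -/S (negPf iS).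
by case: ifPn => // /(subsetP BA); rewrite (negPf iA).
Qed.

Lemma sample_parity_pmf_sum1 f (p : R) : \sum_A sample_parity_pmf f p A = 1.
Proof.
have := @sample_parity_prob_supset f p set0 (sub0set _).
rewrite cards0 expr0 => <-.
by apply: eq_bigl => A; rewrite inE sub0set.
Qed.

Definition parity_span (A : {set cube n}) : {vspace cube n} := <<enum A>>%VS.

Definition vcoset (G : {vspace cube n}) (v : cube n) : {set cube n} :=
  [set v + g | g in G].

Definition num_support_cosets f (G : {vspace cube n}) : nat :=
  #|[set C in [set vcoset G v | v : cube n] | C :&: fourier_support f != set0]|.

End Fourier.

(* Main.v *)
(* Fix [a] in the support [S] with at least [delta k / 3] folding partners (there
   are at least [delta k / 3] such [a]), and join [x] and [y] when [x + y + a] lies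
   in [S]: as soon as both ends of an edge are sampled, [a] shares its coset with
   [x + y + a].  The edges are partitioned into triangles [x, y, x + y + a], so a
   maximal subgraph [F] of maximal degree [D ~ 1 / (4 p)] is large: a triangle
   missed by [F] has two saturated vertices, these determine the triangle, and
   there are at most [2 |F| / D] saturated vertices.  Since sampled edges of [F]
   rarely overlap, a Janson-type argument bounds the probability that none is
   sampled by [(1 - p^2 / 2)^|F| <= 1 / k^2].  A union bound over [a] concludes,
   as every coset containing such an [a] has at least two points of [S]. *)
Require Import Defs.
From HB Require Import structures.
From mathcomp Require Import all_boot all_order all_algebra.
From mathcomp Require Import reals sequences exp.
From mathcomp Require Import ring lra.

Set Implicit Arguments.
Unset Strict Implicit.
Unset Printing Implicit Defensive.

Import Order.TTheory GRing.Theory Num.Theory.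
Local Open Scope ring_scope.

(** * Bernoulli random subsets of a finite set *)

Section RandomSubset.
Context {R : realType} {T : finType} (S : {set T}) (p : R).
Hypotheses (p_ge0 : 0 <= p) (p_le1 : p <= 1).

(** The mass function [sample_parity_pmf] over an arbitrary finite type; for [S] the Fourier support
    the two are convertible. *)
Definition subset_weight (A : {set T}) : R :=
  if A \subset S then \prod_(a in S) (if a \in A then p else 1 - p) else 0.

Definition subset_prob (E : pred {set T}) : R := \sum_(A | E A) subset_weight A.

Lemma subset_weight_ge0 A : 0 <= subset_weight A.
Proof.
rewrite /subset_weight; case: ifP => // _; apply: prodr_ge0 => a _.
by case: ifP => // _; rewrite subr_ge0.
Qed.

Lemma subset_prob_ge0 E : 0 <= subset_prob E.
Proof. by apply: sumr_ge0 => A _; apply: subset_weight_ge0. Qed.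

Lemma subset_prob_le (E E' : pred {set T}) :
  (forall A, E A -> E' A) -> subset_prob E <= subset_prob E'.
Proof.
move=> EE'; rewrite /subset_prob [leLHS]big_mkcond [leRHS]big_mkcond.
apply: ler_sum => A _; case: ifP => [/EE' -> //|_].
by case: ifP => // _; apply: subset_weight_ge0.
Qed.

Lemma subset_probID (B E : pred {set T}) :
  subset_prob E = subset_prob (fun A : {set T} => B A && E A)
                + subset_prob (fun A : {set T} => ~~ B A && E A).
Proof.
rewrite /subset_prob (bigID B) /=; congr (_ + _); apply: eq_bigl => A;
by rewrite andbC.
Qed.

(** Expand a product over [T] whose factors are [p + (1 - p)] on [S] and [0 + 1] off [S]; the zeros
    kill every set not contained in [S]. *)
Lemma subset_prob1 : subset_prob predT = 1.
Proof.
transitivity (\prod_(a : T) ((if a \in S then p else 0)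
                            + (if a \in S then 1 - p else 1))).
  rewrite bigA_distr; apply: eq_bigr => A _; rewrite /subset_weight.
  case: ifPn => [/subsetP AS|/subsetPn[a aA /negPf aS]]; last first.
    by rewrite (bigD1 a) //= aA aS mul0r.
  rewrite big_mkcond; apply: eq_bigr => a _.
  by case: ifP => aS; case: ifP => // /AS; rewrite aS.
by apply: big1 => a _; case: ifP => _; rewrite ?add0r // subrKC.
Qed.

Lemma subset_prob_has (I : finType) (J : {set I}) (E : I -> pred {set T}) :
  subset_prob (fun A : {set T} => [exists i in J, E i A])
    <= \sum_(i in J) subset_prob (E i).
Proof.
rewrite /subset_prob big_mkcond /=.
under [leRHS]eq_bigr do rewrite big_mkcond.
rewrite exchange_big /=; apply: ler_sum => A _.
have w_ge0 := subset_weight_ge0 A.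
case: ifPn => [/existsP[i /andP[iJ EiA]]|_].
  rewrite (bigD1 i) //= EiA lerDl; apply: sumr_ge0 => j _.
  by case: ifP.
by apply: sumr_ge0 => j _; case: ifP.
Qed.

Lemma subset_weightU1 w (A : {set T}) : w \in S -> w \notin A ->
  (1 - p) * subset_weight (w |: A) = p * subset_weight A.
Proof.
move=> wS wA; rewrite /subset_weight subUset sub1set wS /=.
case: ifP => _; last by rewrite !mulr0.
rewrite (bigD1 w) //= [in RHS](bigD1 w) //= setU11 (negPf wA) mulrCA.
do 2!congr (_ * _); apply: eq_bigr => a /andP[_ /negPf aw].
by rewrite !inE aw.
Qed.

(** Inserting [w] is a bijection from the sets avoiding [w] to those containing it, and trades one
    factor [1 - p] for [p]. The multiplied-out form covers [p = 1]. *)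
Lemma subset_prob_shift w (E : pred {set T}) : w \in S ->
  (1 - p) * subset_prob (fun A : {set T} => (w \in A) && E A)
    = p * subset_prob (fun A : {set T} => (w \notin A) && E (w |: A)).
Proof.
move=> wS; rewrite /subset_prob !mulr_sumr.
rewrite (reindex_onto (fun A : {set T} => w |: A) (fun A : {set T} => A :\ w)) /=; last first.
  by move=> A /andP[wA _]; rewrite setD1K.
rewrite (eq_bigl (fun A : {set T} => (w \notin A) && E (w |: A))) => [|A].
  by apply: eq_bigr => A /andP[wA _]; apply: subset_weightU1.
rewrite setU11 /= andbC; congr (_ && _).
apply/eqP/idP => [<-|wA]; first by rewrite setD11.
by rewrite setU1K.
Qed.

(** A one-vertex case of Harris's inequality: an event that is decreasing in [w] is negatively
    correlated with the sampling of [w]. *)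
Lemma subset_prob_in_le w (E : pred {set T}) : w \in S ->
  (forall A, E (w |: A) -> E A) ->
  subset_prob (fun A : {set T} => (w \in A) && E A) <= p * subset_prob E.
Proof.
move=> wS Edown; rewrite -subr_ge0.
have /= EID := subset_probID (fun A : {set T} => w \in A) E.
have := subset_prob_shift E wS.
have /(ler_wpM2l p_ge0) :
    subset_prob (fun A : {set T} => (w \notin A) && E (w |: A))
      <= subset_prob (fun A : {set T} => (w \notin A) && E A).
  by apply: subset_prob_le => A /andP[-> /Edown].
rewrite EID; lra.
Qed.

Lemma subset_prob_in_indep w (E : pred {set T}) : w \in S ->
  (forall A, E (w |: A) = E A) ->
  subset_prob (fun A : {set T} => (w \in A) && E A) = p * subset_prob E.
Proof.
move=> wS Einv.
have /= EID := subset_probID (fun A : {set T} => w \in A) E.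
have := subset_prob_shift E wS.
have -> : subset_prob (fun A : {set T} => (w \notin A) && E (w |: A))
        = subset_prob (fun A : {set T} => (w \notin A) && E A).
  by apply: eq_bigl => A; rewrite Einv.
rewrite EID; lra.
Qed.

(** * A Janson-type bound for graphs of small degree *)

Definition edge_free (F : {set {set T}}) : pred {set T} :=
  fun A : {set T} => [forall e in F, ~~ (e \subset A)].

Definition edge_degree (F : {set {set T}}) (v : T) : nat :=
  #|[set e in F | v \in e]|.

Lemma edge_freeS (F F' : {set {set T}}) (A : {set T}) :
  F \subset F' -> edge_free F' A -> edge_free F A.
Proof.
move=> FF' /forall_inP fA; apply/forall_inP => e eF.
exact/fA/(subsetP FF').
Qed.

Lemma edge_free_down (F : {set {set T}}) (A B : {set T}) :
  A \subset B -> edge_free F B -> edge_free F A.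
Proof.
move=> AB /forall_inP fB; apply/forall_inP => e /fB.
by apply: contraNN => /subset_trans; apply.
Qed.

Lemma edge_freeU1 (F : {set {set T}}) w (A : {set T}) :
  (forall e, e \in F -> w \notin e) -> edge_free F (w |: A) = edge_free F A.
Proof.
move=> wF; apply: eq_forallb_in => e /wF we; congr (~~ _).
apply/subsetP/subsetP => eA v ve; last by rewrite !inE eA // orbT.
by have := eA v ve; rewrite !inE => /predU1P[vw|//]; rewrite -vw ve in we.
Qed.

(** Induction on the number of edges. Removing [e] leaves [F'], and it suffices that [e] is sampled
    while [F'] is avoided with probability at least [p ^+ 2 / 2] times that of avoiding [F']. Edges
    disjoint from [e] are independent of it; the at most [2 * D] others are sampled, given [e], with
    total probability at most [2 * D * p <= 1 / 2]. *)
Lemma subset_prob_edge_free (D : nat) (F : {set {set T}}) :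
  4 * D%:R * p <= 1 ->
  (forall e, e \in F -> #|e| = 2%N /\ e \subset S) ->
  (forall v, (edge_degree F v <= D)%N) ->
  subset_prob (edge_free F) <= (1 - p ^+ 2 / 2) ^+ #|F|.
Proof.
move=> Dp; have [m] := ubnP #|F|; elim: m F => // m IH F /ltnSE Fm F2 FD.
have [->|[e eF]] := set_0Vmem F.
  by rewrite cards0 expr0 -subset_prob1; apply: subset_prob_le.
pose F' := F :\ e; pose D0 := edge_free [set g in F' | [disjoint e & g]].
have F'F : F' \subset F by apply: subD1set.
have [e2 eS] := F2 e eF.
have [x [y [xy exy]]] : exists x, exists y, x != y /\ e = [set x; y].
  by have /eqP/cards2P[x [y [xy ->]]] := e2; exists x, y.
have [xS yS] : x \in S /\ y \in S.
  by split; apply: (subsetP eS); rewrite exy !inE eqxx ?orbT.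
have D0e w (A : {set T}) : w \in e -> D0 (w |: A) = D0 A.
  move=> we; apply: edge_freeU1 => g; rewrite inE => /andP[_ /pred0P/(_ w)].
  by rewrite /= we /= => ->.
have eE (A : {set T}) : (e \subset A) = (x \in A) && (y \in A).
  by rewrite exy subUset !sub1set.
have PeD0 : subset_prob (fun A : {set T} => (e \subset A) && D0 A) = p ^+ 2 * subset_prob D0.
  transitivity (subset_prob (fun A : {set T} => (x \in A) && ((y \in A) && D0 A))).
    by apply: eq_bigl => A; rewrite eE andbA.
  rewrite subset_prob_in_indep // => [|A]; last first.
    by rewrite D0e ?exy ?inE ?eqxx // eq_sym (negPf xy).
  rewrite subset_prob_in_indep // => [|A]; last first.
    by rewrite D0e ?exy ?inE ?eqxx ?orbT.
  by rewrite mulrA -expr2.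
(* [D0] is independent of [e], and given both, at most [2 D] edges of [F'] can
   still be hit, each needing one more vertex. *)
pose J := [set g in F' | ~~ [disjoint e & g]].
have J_le : (#|J| <= 2 * D)%N.
  apply: (@leq_trans #|[set g in F | x \in g] :|: [set g in F | y \in g]|).
    apply/subset_leq_card/subsetP => g; rewrite !inE => /andP[/andP[_ ->]] /=.
    rewrite exy; apply: contraNT; rewrite negb_or => /andP[xg yg].
    rewrite disjoint_subset; apply/subsetP => v.
    by rewrite !inE => /orP[]/eqP->.
  by rewrite (leq_trans (leq_card_setU _ _)) // mul2n -addnn leq_add // FD.
have PJ g : g \in J ->
    subset_prob (fun A : {set T} => [&& g \subset A, e \subset A & D0 A])
      <= p * (p ^+ 2 * subset_prob D0).
  rewrite inE => /andP[gF' _].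
  have [ge gF] : g != e /\ g \in F by apply/andP; rewrite -in_setD1.
  have [g2 gS] := F2 g gF.
  (* Sampling [g] requires a vertex [w] outside [e]. The event that [e] is sampled and [D0] holds is
     decreasing in [w], so this costs a factor [p]. *)
  have /subsetPn[w wg we] : ~~ (g \subset e).
    by apply: contra ge => ge; rewrite eqEcard ge g2 e2.
  rewrite -PeD0; apply: le_trans (subset_prob_in_le (subsetP gS w wg) _).
    apply: subset_prob_le => A /and3P[gA -> ->].
    by rewrite (subsetP gA).
  move=> A /andP[eA dA]; apply/andP; split; last first.
    exact: edge_free_down (subsetUr _ _) dA.
  have [xw yw] : x != w /\ y != w.
    by move: we; rewrite exy !inE negb_or ![w == _]eq_sym => /andP.
  by move: eA; rewrite !eE !inE (negPf xw) (negPf yw).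
have D0_ge0 := subset_prob_ge0 D0.
have PD0 : subset_prob (edge_free F') <= subset_prob D0.
  apply: subset_prob_le => A; apply: edge_freeS.
  by apply/subsetP => g; rewrite inE => /andP[].
(* If [e] is sampled and [D0] holds but [F'] is not avoided, a sampled edge of [F'] meets [e], hence
   lies in [J]; a union bound with [PJ] applies. *)
have PeF' : p ^+ 2 * subset_prob D0 * (1 - p * #|J|%:R)
    <= subset_prob (fun A : {set T} => (e \subset A) && edge_free F' A).
  have /= := subset_probID (edge_free F') (fun A : {set T} => (e \subset A) && D0 A).
  have : subset_prob (fun A : {set T} => edge_free F' A && ((e \subset A) && D0 A))
      <= subset_prob (fun A : {set T} => (e \subset A) && edge_free F' A).
    by apply: subset_prob_le => A /and3P[-> ->].
  have : subset_prob (fun A : {set T} => ~~ edge_free F' A && ((e \subset A) && D0 A))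
      <= #|J|%:R * (p * (p ^+ 2 * subset_prob D0)).
    rewrite mulr_natl -sumr_const.
    apply: le_trans (ler_sum _ PJ); apply: le_trans (subset_prob_has _ _).
    apply: subset_prob_le => A /and3P[/forall_inPn[g gF' /negPn gA] eA dA].
    apply/existsP; exists g; rewrite gA eA dA !inE -in_setD1 gF' !andbT /=.
    apply: contraL gA => eg; apply: (forall_inP dA).
    by rewrite inE gF'.
  rewrite PeD0; lra.
have -> : subset_prob (edge_free F) = subset_prob (edge_free F')
          - subset_prob (fun A : {set T} => (e \subset A) && edge_free F' A).
  have /= -> := subset_probID (fun A : {set T} => e \subset A) (edge_free F').
  rewrite addrAC subrr add0r; apply: eq_bigl => A.
  apply/forall_inP/andP => [fF|[eA /forall_inP fF'] g gF].
    by split; [apply: fF | apply: edge_freeS F'F _; apply/forall_inP].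
  by have [->//|ge] := eqVneq g e; apply: fF'; rewrite in_setD1 ge.
rewrite (cardsD1 e) eF add1n exprS.
have J_half : 2^-1 <= 1 - p * #|J|%:R.
  have : #|J|%:R <= 2 * D%:R :> R by rewrite -natrM ler_nat.
  move=> /(ler_wpM2l p_ge0); lra.
have c_ge0 : 0 <= 1 - p ^+ 2 / 2 by have := exprn_ile1 2 p_ge0 p_le1; lra.
have IHP : p ^+ 2 * subset_prob (edge_free F') / 2
     <= p ^+ 2 * subset_prob D0 * (1 - p * #|J|%:R).
  rewrite -[leLHS]mulrA -[leRHS]mulrA; apply: ler_wpM2l.
    exact: exprn_ge0.
  by apply: ler_pM => //; [apply: subset_prob_ge0 | rewrite invr_ge0].
have IHF' : subset_prob (edge_free F') <= (1 - p ^+ 2 / 2) ^+ #|F'|.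
  apply: IH => [|g /(subsetP F'F)/F2 //|v]; first by rewrite (cardsD1 e) eF in Fm.
  apply: leq_trans (FD v); apply/subset_leq_card/subsetP => g.
  by rewrite !inE => /andP[/andP[_ ->] ->].
apply: le_trans _ (ler_wpM2l c_ge0 IHF').
by move: IHP PeF'; clear; lra.
Qed.

End RandomSubset.

(** * Counting along fibers *)

Lemma card_fibers (T U : finType) (f : T -> U) (A : {set T}) (B : {set U}) :
  (forall x, x \in A -> f x \in B) ->
  #|A| = (\sum_(u in B) #|[set x in A | f x == u]|)%N.
Proof.
move=> AB; rewrite -sum1_card (partition_big f (mem B)) //=.
by apply: eq_bigr => u _; rewrite -sum1_card; apply: eq_bigl => x; rewrite inE.
Qed.

(** Compare fiber by fiber: every fiber has a point of [A], and one that meets [L] has two. With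
    [L = A] this says that the image has at most half the size of [A]. *)
Lemma card_imset_partner (T U : finType) (f : T -> U) (L A : {set T}) :
  L \subset A ->
  (forall x, x \in L -> exists y, [/\ y \in A, y != x & f y = f x]) ->
  (2 * #|f @: A| + #|L| <= 2 * #|A|)%N.
Proof.
move=> LA partner; have AB x : x \in A -> f x \in f @: A by apply: imset_f.
have LB x : x \in L -> f x \in f @: A by move=> /(subsetP LA)/AB.
rewrite (card_fibers LB) [X in (_ <= 2 * X)%N](card_fibers AB) -sum1_card.
rewrite !big_distrr -big_split /=; apply: leq_sum => _ /imsetP[x xA ->].
have A_gt0 : (0 < #|[set y in A | f y == f x]|)%N.
  by apply/card_gt0P; exists x; rewrite inE xA eqxx.
have [->|[y]] := set_0Vmem [set y in L | f y == f x].
  by rewrite cards0 addn0 muln1 leq_pmulr.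
rewrite inE => /andP[yL /eqP fyx]; have [z [zA zy fzy]] := partner y yL.
rewrite [leqRHS]mul2n -addnn leq_add //.
  apply: (@leq_trans #|[set z; y]|); first by rewrite cards2 zy.
  apply/subset_leq_card/subsetP => v; rewrite !inE => /orP[]/eqP->.
    by rewrite zA fzy fyx eqxx.
  by rewrite (subsetP LA) // fyx eqxx.
by apply/subset_leq_card/subsetP => v; rewrite !inE => /andP[/(subsetP LA)-> ->].
Qed.

Lemma set2_eq (T : finType) (x y a b : T) : x != y ->
  [set x; y] = [set a; b] -> (x, y) \in [set (a, b); (b, a)].
Proof.
move=> xy eq_xy.
have : x \in [set a; b] by rewrite -eq_xy !inE eqxx.
have : y \in [set a; b] by rewrite -eq_xy !inE eqxx orbT.
rewrite !inE !xpair_eqE => /orP[]/eqP yE /orP[]/eqP xE; move: xy;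
by rewrite xE yE ?eqxx ?orbT.
Qed.

(** * The graph of triangles attached to [a] *)

Section Triangles.
Context {n : nat} (S : {set cube n}) (a : cube n).
Implicit Types x y : cube n.

(* Each pair below lies in the triangle [x], [y], [x + y + a], and distinct
   triangles share no edge. *)
Definition triangle_pairs : {set cube n * cube n} :=
  [set u | [&& u.1 \in S :\ a, u.2 \in S :\ a & u.1 + u.2 + a \in S :\ a]].

Definition triangle_edges : {set {set cube n}} :=
  [set [set u.1; u.2] | u in triangle_pairs].

Lemma cube_addK x y : x + y + y = x.
Proof. by rewrite -addrA -{2}(cube_oppr y) subrr addr0. Qed.

Lemma cube_addKl x y : x + (x + y) = y.
Proof. by rewrite addrA (addrC _ y) addrA cube_addK. Qed.

Lemma triangle_pairs_neq x y : (x, y) \in triangle_pairs -> x != y.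
Proof.
rewrite !inE /= => /and3P[_ _ /andP[+ _]]; apply: contraNneq => ->.
by rewrite addrC addrA cube_addK.
Qed.

(** With [z = x + y + a], the relation reads [x + y + z = a] in characteristic two, which is
    symmetric in the three vertices. *)
Lemma triangle_pairs_rot x y : (x, y) \in triangle_pairs ->
  (y, x + y + a) \in triangle_pairs /\ (x, x + y + a) \in triangle_pairs.
Proof.
rewrite !inE /= => /and3P[xS yS zS]; rewrite xS yS zS /=.
have -> : y + (x + y + a) + a = x by rewrite addrA cube_addK addrC cube_addK.
have -> : x + (x + y + a) + a = y.
  by rewrite addrA cube_addK (addrC x y) addrC cube_addK.
by rewrite xS yS.
Qed.

Lemma triangle_edges_card e : e \in triangle_edges -> #|e| = 2%N.
Proof.
by case/imsetP => -[x y] /triangle_pairs_neq /= xy ->; rewrite cards2 xy.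
Qed.

Lemma triangle_edges_sub e : e \in triangle_edges -> e \subset S.
Proof.
case/imsetP => -[x y]; rewrite !inE /= => /and3P[/andP[_ xS] /andP[_ yS] _] ->.
by apply/subsetP => v; rewrite !inE => /orP[]/eqP->.
Qed.

Lemma card_pairs_of_edges (F : {set {set cube n}}) :
  F \subset triangle_edges ->
  (#|[set u : cube n * cube n | [set u.1; u.2] \in F]| <= 2 * #|F|)%N.
Proof.
move=> FG; set B := [set u | _].
rewrite (@card_fibers _ _ (fun u => [set u.1; u.2]) B F); last by move=> u; rewrite inE.
rewrite mulnC -sum_nat_const; apply: leq_sum => e eF.
have e2 := triangle_edges_card (subsetP FG e eF).
have /imsetP[[x y] _ /= exy] := subsetP FG e eF.
apply: (@leq_trans #|[set (x, y); (y, x)]|); last by rewrite cards2; case: (_ != _).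
apply/subset_leq_card/subsetP => -[x' y']; rewrite inE /= => /andP[_ /eqP e'].
apply: set2_eq; last by rewrite e'.
by move: e2; rewrite -e' cards2; case: (x' != y').
Qed.

(** Take [F] inclusion-maximal among the subgraphs of degree at most [D]: a missing edge whose ends
    both had degree below [D] could be added. *)
Lemma saturated_edges (D : nat) :
  exists F : {set {set cube n}},
    [/\ F \subset triangle_edges, forall v, (edge_degree F v <= D)%N &
        forall e, e \in triangle_edges -> e \notin F ->
          exists2 v, v \in e & (D <= edge_degree F v)%N].
Proof.
pose P (F : {set {set cube n}}) :=
  (F \subset triangle_edges) && [forall v, (edge_degree F v <= D)%N].
have P0 : P set0.
  rewrite /P sub0set; apply/forallP => v; rewrite (_ : edge_degree _ _ = 0)%N //.
  by apply: eq_card0 => e; rewrite !inE.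
have [F /maxsetP[/andP[FG /forallP FD] Fmax] _] := maxset_exists P0.
exists F; split=> // e eG eF; apply/exists_inP; apply: contraNT eF.
move=> /exists_inPn eD; rewrite -(Fmax (e |: F)) ?setU11 ?subsetUr //.
rewrite /P subUset sub1set eG FG; apply/forallP => v.
have [ve|ve] := boolP (v \in e).
  have := eD v ve; rewrite -ltnNge; apply: leq_trans.
  apply: (@leq_trans #|e |: [set g in F | v \in g]|).
    apply/subset_leq_card/subsetP => g.
    by rewrite !inE => /andP[/orP[->//|->] ->]; rewrite orbT.
  by rewrite cardsU1 /edge_degree; case: (_ \notin _).
apply: leq_trans (FD v); apply/subset_leq_card/subsetP => g.
rewrite !inE => /andP[/predU1P[->|-> -> //]].
by rewrite (negPf ve).
Qed.

Lemma sum_edge_degree (F : {set {set cube n}}) :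
  F \subset triangle_edges -> (\sum_v edge_degree F v = 2 * #|F|)%N.
Proof.
move=> FG; rewrite mulnC -sum_nat_const.
under eq_bigr do rewrite /edge_degree -sum1_card.
rewrite (exchange_big_dep (mem F)) /= => [|v e _]; last by rewrite inE => /andP[].
apply: eq_bigr => e eF; transitivity #|e|.
  by rewrite -sum1_card; apply: eq_bigl => v; rewrite inE eF.
exact/triangle_edges_card/(subsetP FG).
Qed.

(** With [Z] the saturated vertices, each triangle has a side in [F] or joining two points of [Z],
    so there are at most [3 * (2 * #|F| + #|Z| ^ 2)] ordered pairs. Degree counting gives
    [#|Z| * D <= 2 * #|F|]; the factor [D ^ 2] avoids division. *)
Lemma sparse_triangle_edges (D : nat) :
  exists F : {set {set cube n}},
    [/\ F \subset triangle_edges, forall v, (edge_degree F v <= D)%N &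
        (#|triangle_pairs| * D ^ 2 <= 6 * #|F| * D ^ 2 + 12 * #|F| ^ 2)%N].
Proof.
have [F [FG FD Fsat]] := saturated_edges D; exists F; split=> //.
pose Z := [set v | (D <= edge_degree F v)%N].
have ZD : (#|Z| * D <= 2 * #|F|)%N.
  rewrite -sum_nat_const -(sum_edge_degree FG).
  apply: (@leq_trans (\sum_(v in Z) edge_degree F v)).
    by apply: leq_sum => v; rewrite inE.
  by rewrite [leqRHS](bigID (mem Z)) leq_addr.
pose B := [set u : cube n * cube n | [set u.1; u.2] \in F] :|: setX Z Z.
have B_le : (#|B| <= 2 * #|F| + #|Z| ^ 2)%N.
  rewrite (leq_trans (leq_card_setU _ _)) // cardsX leq_add //.
  exact: card_pairs_of_edges.
(* [phi] and [psi] give the other two sides of the triangle; being injective, they pull [B] back to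
   sets that are no larger. *)
pose phi (u : cube n * cube n) := (u.2, u.1 + u.2 + a).
pose psi (u : cube n * cube n) := (u.1, u.1 + u.2 + a).
have phi_inj : injective phi.
  by move=> [x y] [x' y'] [/= -> /addIr/addIr->].
have psi_inj : injective psi.
  by move=> [x y] [x' y'] [/= -> /addIr/addrI->].
have preim_le (h : cube n * cube n -> cube n * cube n) :
    injective h -> (#|h @^-1: B| <= #|B|)%N.
  move=> h_inj; rewrite -(card_imset _ h_inj); apply/subset_leq_card/subsetP.
  by move=> _ /imsetP[u + ->]; rewrite inE.
(* If no side lies in [F], each of the three sides has a saturated end. Then at least two vertices
   are saturated, and the side joining them lies in [setX Z Z]. *)
have cover : triangle_pairs \subset B :|: (phi @^-1: B) :|: (psi @^-1: B).
  apply/subsetP => -[x y] xyP.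
  have [yzP xzP] := triangle_pairs_rot xyP.
  have sat x' y' : (x', y') \in triangle_pairs ->
      [|| [set x'; y'] \in F, x' \in Z | y' \in Z].
    move=> uP; case: (boolP (_ \in F)) => //= uF.
    have [] := Fsat [set x'; y'] _ uF.
      by apply/imsetP; exists (x', y').
    by move=> v; rewrite !inE => /orP[]/eqP-> ->; rewrite ?orbT.
  move: (sat _ _ xyP) (sat _ _ yzP) (sat _ _ xzP).
  rewrite !in_setU [in X in _ -> _ -> _ -> X]inE.
  rewrite [_ \in phi @^-1: _]inE [_ \in psi @^-1: _]inE !in_setU !in_setX /=.
  rewrite ![_ \in [set u | _]]inE /=.
  by do 3!case: (_ \in F) => //=; do 3!case: (D <= _)%N => //=.
have P_le : (#|triangle_pairs| <= 3 * #|B|)%N.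
  apply: leq_trans (subset_leq_card cover) _.
  rewrite (leq_trans (leq_card_setU _ _)) // [leqRHS]mulSn addnC leq_add ?preim_le //.
  by rewrite (leq_trans (leq_card_setU _ _)) // mul2n -addnn leq_add ?preim_le.
apply: leq_trans (leq_mul P_le (leqnn _)) _.
apply: (@leq_trans (3 * (2 * #|F| + #|Z| ^ 2) * D ^ 2)).
  by rewrite leq_mul2r leq_mul2l B_le !orbT.
have : ((#|Z| * D) ^ 2 <= (2 * #|F|) ^ 2)%N by rewrite leq_exp2r.
rewrite (mulnDr 3) mulnDl (mulnA 3 2) leq_add2l -(mulnA 3) !expnMn => ZD2.
by apply: leq_trans (leq_mul (leqnn 3) ZD2) _; rewrite mulnA.
Qed.

End Triangles.

(** * From the folding property to triangles and merged cosets *)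

Section FoldingNeighbors.
Context {R : realType} {n : nat} (f : cube n -> R) (l : R).
Implicit Types x y : cube n.
Local Notation S := (fourier_support f).
Local Notation k := (sparsity f).

Definition folding_neighbors x : {set cube n} :=
  [set y in S | (x != y) && (k%:R `^ l + 1 <= #|support_pairs f (x + y)|%:R)].

(** A pair with sum [a + x] has the form [[set y; x + y + a]], and its two members are distinct
    choices of [y] because [a != x]. *)
Lemma card_support_pairs a x : a != x ->
  (2 * #|support_pairs f (a + x)%R| <= #|[set y in S | (x + y + a)%R \in S]|)%N.
Proof.
move=> ax; set Y := [set y in S | _].
pose h y := [set y; y + (a + x)].
have hY : (2 * #|h @: Y| <= #|Y|)%N.
  suff : (2 * #|h @: Y| + #|Y| <= 2 * #|Y|)%N.
    by rewrite [leqRHS]mul2n -addnn leq_add2r.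
  apply: card_imset_partner => // y.
  rewrite inE => /andP[yS zS]; exists (y + (a + x)).
  have zE : y + (a + x) = x + y + a by rewrite (addrC a) addrA (addrC y).
  split; last by rewrite /h cube_addK setUC.
    by rewrite inE zE zS -(addrA x) cube_addK cube_addKl yS.
  by rewrite addrC -subr_eq0 addrK addr_eq0 cube_oppr.
apply: leq_trans hY; rewrite leq_mul2l; apply/subset_leq_card/subsetP => w.
case/imset2P=> y z yS; rewrite inE => /andP[zS /andP[_ /eqP yz]] ->.
have zE : z = y + (a + x) by rewrite -yz cube_addKl.
apply/imsetP; exists y; last by rewrite /h -zE.
by rewrite inE yS (addrC x) -addrA (addrC x) -zE.
Qed.

(** The [+ 2] pays for the degenerate choices [y = a] and [y = x], which make the second,
    respectively third, vertex equal to [a]. *)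
Lemma card_triangle_pairs_at a x : a != x -> a \in S -> x \in S ->
  (2 * #|support_pairs f (a + x)%R| <=
     #|[set u in triangle_pairs S a | u.1 == x]| + 2)%N.
Proof.
move=> ax aS xS; apply: leq_trans (card_support_pairs ax) _.
set Y := [set y in S | _]; set P := [set u in _ | _].
apply: (@leq_trans #|(snd @: P) :|: [set a; x]|); last first.
  apply: leq_trans (leq_card_setU _ _) _; apply: leq_add.
    exact: leq_imset_card.
  by rewrite cards2; case: (_ != _).
apply/subset_leq_card/subsetP => y; rewrite inE => /andP[yS zS].
rewrite !inE; case: (eqVneq y a) => [|ya]; first by rewrite orbT.
case: (eqVneq y x) => [|yx]; first by rewrite !orbT.
rewrite !orbF; apply/imsetP; exists (x, y) => //.
rewrite inE eqxx andbT inE /= !in_setD1 xS yS zS ya (eq_sym x a) ax !andbT /=.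
by rewrite -subr_eq0 addrK addr_eq0 cube_oppr eq_sym.
Qed.

(** Sum over the first vertex [x]. The [+ 1] in the folding threshold, once doubled, absorbs exactly
    the two degenerate pairs. *)
Lemma card_triangle_pairs_ge a : a \in S ->
  #|folding_neighbors a|%:R * (2 * k%:R `^ l) <= #|triangle_pairs S a|%:R :> R.
Proof.
move=> aS.
rewrite (@card_fibers _ _ fst (triangle_pairs S a) setT) // natr_sum.
rewrite (bigID (mem (folding_neighbors a))) /=.
apply: (@le_trans _ _ (\sum_(x in folding_neighbors a)
          #|[set u in triangle_pairs S a | u.1 == x]|%:R)).
  rewrite mulr_natl -sumr_const; apply: ler_sum => x.
  rewrite inE => /and3P[xS ax fold].
  have := card_triangle_pairs_at ax aS xS.
  rewrite -(ler_nat R) natrD natrM => H; move: fold H; clear; lra.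
rewrite (eq_bigl (fun x => x \in folding_neighbors a)) ?lerDl ?sumr_ge0 //.
by move=> x; rewrite inE.
Qed.

Lemma folding_degree_sum (delta : R) : folding f delta l ->
  delta * k%:R * (k%:R - 1) <= \sum_(x in S) #|folding_neighbors x|%:R.
Proof.
rewrite /folding => fold.
pose Q := [set u : cube n * cube n | (u.1 \in S) && (u.2 \in folding_neighbors u.1)].
have inQ x y : ((x, y) \in Q) = [&& x \in S, y \in S, x != y &
    k%:R `^ l + 1 <= #|support_pairs f (x + y)|%:R] by rewrite !inE.
have QE : #|Q| = (\sum_(x in S) #|folding_neighbors x|)%N.
  rewrite (@card_fibers _ _ fst Q S) => [|u]; last by rewrite inE => /andP[].
  apply: eq_bigr => x xS; rewrite -(card_imset (folding_neighbors x) (f := pair x)).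
    apply: eq_card => u; rewrite 2!inE; apply/andP/imsetP.
      by move=> [/andP[_ uN] /eqP ux]; exists u.2; rewrite -ux -?surjective_pairing.
    by move=> [y yN ->] /=; rewrite xS yN.
  by move=> y y' [].
have Q2 : (2 * #|folding_pairs f l| <= #|Q|)%N.
  have QQ : (2 * #|[set [set u.1; u.2] | u in Q]| + #|Q| <= 2 * #|Q|)%N.
    apply: card_imset_partner => // -[x y]; rewrite inQ => /and4P[xS yS xy xyf].
    exists (y, x); split; last by rewrite /= setUC.
      by rewrite inQ xS yS eq_sym xy (addrC y).
    by rewrite xpair_eqE negb_and eq_sym xy.
  move: QQ; rewrite [leqRHS]mul2n -addnn leq_add2r; apply: leq_trans.
  rewrite leq_mul2l; apply/subset_leq_card/subsetP => w.
  case/imset2P=> x y xS; rewrite inE => /and3P[yS xy xyf] ->.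
  by apply/imsetP; exists (x, y) => //; rewrite inQ xS yS xy.
rewrite -natr_sum -QE; move: Q2; rewrite -(ler_nat R) natrM.
have : (k * k.-1)%:R = 2 * 'C(k, 2)%:R :> R.
  by have := bin_ffact k 2; rewrite ffactnS ffactn1 => <-; rewrite mulnC natrM.
have -> : (k * k.-1)%:R = k%:R * (k%:R - 1) :> R.
  by case: (k) => [|m]; rewrite ?mul0n ?mul0r // natrM -natr1 addrK.
rewrite -mulrA => ->; lra.
Qed.

Definition folding_core (delta : R) : {set cube n} :=
  [set x in S | delta * k%:R / 3 <= #|folding_neighbors x|%:R].

(** Averaging: degrees are at most [k] on the core and below [delta * k / 3] off it, so the core has
    at least [delta * (k - 1) - delta * k / 3] points; [3 <= k] gives the bound. *)
Lemma card_folding_core (delta : R) : 0 < delta -> (3 <= k)%N ->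
  folding f delta l -> delta * k%:R / 3 <= #|folding_core delta|%:R.
Proof.
move=> delta0 k3 /folding_degree_sum; set C := folding_core delta.
rewrite (bigID (mem C)) /= => sum_ge.
have k3R : 3 <= k%:R :> R by rewrite ler_nat.
have sumC : \sum_(x in S | x \in C) #|folding_neighbors x|%:R <= #|C|%:R * k%:R :> R.
  rewrite mulr_natl -sumr_const (eq_bigl (mem C)) => [|x]; last first.
    by apply: andb_idl; rewrite inE => /andP[].
  apply: ler_sum => x _; rewrite ler_nat; apply/subset_leq_card/subsetP => y.
  by rewrite inE => /andP[].
have sumNC : \sum_(x in S | x \notin C) #|folding_neighbors x|%:R
    <= k%:R * (delta * k%:R / 3).
  rewrite [leRHS]mulr_natl -sumr_const big_mkcondr /=; apply: ler_sum => x xS.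
  case: ifPn => [xC|_]; last by rewrite divr_ge0 ?mulr_ge0 // ltW.
  by rewrite leNgt; apply: contra xC => /ltW x_ge; rewrite inE; apply/andP.
have k0 : 0 < k%:R :> R by apply: lt_le_trans k3R.
rewrite -(ler_pM2r k0); move: sum_ge sumC sumNC.
have : 0 <= delta * k%:R * (k%:R - 3) by rewrite mulr_ge0 ?subr_ge0 // ltW ?mulr_gt0.
clear; lra.
Qed.

(** The cosets meeting [S] are the image of [S] under [vcoset G], and the hypothesis puts a second
    point of [S] in the coset of each point of [L]. *)
Lemma num_support_cosets_le (G : {vspace cube n}) (L : {set cube n}) :
  L \subset S ->
  (forall x, x \in L -> exists y, [/\ y \in S, y != x & x + y \in G]) ->
  (2 * num_support_cosets f G + #|L| <= 2 * k)%N.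
Proof.
move=> LS partner.
have vcosetD v g : g \in G -> vcoset G (v + g) = vcoset G v.
  move=> gG; apply/setP => w; apply/imsetP/imsetP => -[h hG ->].
    by exists (g + h); rewrite ?rpredD ?addrA.
  by exists (h - g); [exact: rpredB | rewrite -addrA (addrC g) subrK].
apply: leq_trans (card_imset_partner (f := vcoset G) LS _).
  rewrite leq_add2r leq_mul2l; apply/subset_leq_card/subsetP => C.
  rewrite inE => /andP[/imsetP[v _ ->] /set0Pn[s]]; rewrite inE => /andP[+ sS].
  by case/imsetP=> g gG sE; apply/imsetP; exists s; rewrite // sE vcosetD.
move=> x /partner[y [yS yx xyG]]; exists y; split=> //.
by rewrite -(vcosetD x _ xyG) cube_addKl.
Qed.

(** The third vertex is the witness: [a + (x + y + a) = x + y] is a sum of two sampled elements. *)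
Lemma triangle_edge_merges a e (A : {set cube n}) :
  e \in triangle_edges S a -> e \subset A ->
  exists y, [/\ y \in S, y != a & a + y \in parity_span A].
Proof.
case/imsetP=> -[x y]; rewrite inE /= => /and3P[_ _].
rewrite in_setD1 => /andP[za zS] ->.
rewrite subUset !sub1set => /andP[xA yA]; exists (x + y + a); split=> //.
by rewrite (addrC (x + y)) cube_addKl rpredD // memv_span ?mem_enum.
Qed.

End FoldingNeighbors.

(** * Numerical estimates *)

Lemma ln_le_log2 (R : realType) (x : R) : 1 <= x -> ln x <= log2 x.
Proof.
move=> x1; have ln2_gt0 : 0 < ln 2 :> R by rewrite ln_gt0 // ltr1n.
have ln2_le1 : ln 2 <= 1 :> R.
  by rewrite (_ : 2 = 1 + 1) ?le_ln1Dx // (lt_trans _ ltr01) // ltrN10.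
by rewrite /log2 ler_pdivlMr // ler_piMr // ln_ge0.
Qed.

Lemma log2_ge1 (R : realType) (x : R) : 2 <= x -> 1 <= log2 x.
Proof.
move=> x2; have ln2_gt0 : 0 < ln 2 :> R by rewrite ln_gt0 // ltr1n.
rewrite /log2 ler_pdivlMr // mul1r ler_ln ?posrE //.
by apply: lt_le_trans x2.
Qed.

(** Let [t] be the fourth root of [x]. Then [ln x = 4 * ln t <= 4 * t], while the power of [x] is at
    least [t ^+ 2] whatever [l >= 0] is; so [t >= 4 / (c * ln 2)] suffices, uniformly in [l]. *)
Lemma log2_le_powR (R : realType) (c l x : R) : 0 < c -> 0 <= l -> 1 <= x ->
  (4 / (c * ln 2)) ^+ 4 <= x -> log2 x <= c * x `^ ((1 + l) / 2).
Proof.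
move=> c0 l0 x1 x_ge; have x0 : 0 < x by apply: lt_le_trans x1.
have ln2_gt0 : 0 < ln 2 :> R by rewrite ln_gt0 // ltr1n.
have cl0 : 0 < c * ln 2 by apply: mulr_gt0.
set t := x `^ 4^-1; have t0 : 0 < t by apply: powR_gt0.
have t4 : t ^+ 4 = x.
  by rewrite -powR_mulrn ?ltW // -powRrM mulVf ?powRr1 ?ltW ?pnatr_eq0.
have t_ge : 4 / (c * ln 2) <= t.
  by rewrite -(@ler_pXn2r _ 4) ?nnegrE ?t4 // ltW // divr_gt0.
have t2 : t ^+ 2 <= x `^ ((1 + l) / 2).
  rewrite -powR_mulrn ?(ltW t0) // -powRrM; apply: ler_powR => //; lra.
have lnx : ln x <= 4 * t.
  rewrite -t4 lnXn // -[ln t *+ 4]mulr_natl ler_pM2l ?ltr0n //.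
  exact/ltW/ln_sublinear.
rewrite /log2 ler_pdivrMr //.
apply: le_trans lnx _; apply: (@le_trans _ _ (c * t ^+ 2 * ln 2)); last first.
  by rewrite ler_pM2r // ler_pM2l.
move: t_ge; rewrite ler_pdivrMr // => /(ler_wpM2r (ltW t0)).
by move/le_trans; apply; rewrite (_ : t * _ * t = c * t ^+ 2 * ln 2) //; ring.
Qed.

(** Used with [u = log2 k], [s ^+ 2] equal to [k] to the power [1 + l], [N] triangle pairs and [m]
    edges. Multiplying the last hypothesis by [p ^+ 4] leaves only [N * p ^+ 2], [q = p * D] and
    [t = p ^+ 2 * m]. If [t < 4 * u], the right side is at most
    [(24 + 12 * 1024) * u ^+ 2 * q ^+ 2], against at least [10 ^+ 7 * u ^+ 2 * q ^+ 2] on the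
    left. *)
Lemma edge_count_bound (R : realFieldType) (delta s u p N m D : R) :
  0 < delta -> delta <= 1 -> 0 < s -> 1 <= u ->
  p = 4000 * u / (delta * s) -> 1 / 8 <= p * D ->
  2 / 3 * (delta * s ^+ 2) <= N -> 0 <= m ->
  N * D ^+ 2 <= 6 * m * D ^+ 2 + 12 * m ^+ 2 ->
  4 * u <= p ^+ 2 * m.
Proof.
move=> d0 d1 s0 u1 pE pD N_ge m0 ND; rewrite leNgt; apply/negP => m_lt.
set q := p * D in pD *; set t := p ^+ 2 * m in m_lt *.
have t0 : 0 <= t by rewrite mulr_ge0 // sqr_ge0.
have Np : 10 * 1000 ^+ 2 * u ^+ 2 <= N * p ^+ 2.
  apply: (@le_trans _ _ (2 / 3 * (delta * s ^+ 2) * p ^+ 2)); last first.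
    by rewrite ler_wpM2r // sqr_ge0.
  have -> : 2 / 3 * (delta * s ^+ 2) * p ^+ 2 = 2 / 3 * 4000 ^+ 2 * u ^+ 2 / delta.
    by rewrite pE; field; rewrite !gt_eqF.
  rewrite ler_pdivlMr //.
  have : u ^+ 2 * delta <= u ^+ 2 by rewrite ler_piMr // sqr_ge0.
  have := sqr_ge0 u; clear; lra.
have q_gt0 : 0 < q by apply: (lt_le_trans _ pD); rewrite divr_gt0.
have q2 : (1 / 8) ^+ 2 <= q ^+ 2.
  by apply: lerXn2r pD; rewrite nnegrE ?divr_ge0 // ltW.
have NDp : N * p ^+ 2 * q ^+ 2 <= 6 * t * q ^+ 2 + 12 * t ^+ 2.
  have /(ler_wpM2r (exprn_even_ge0 p (isT : ~~ odd 4))) := ND.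
  have -> : N * D ^+ 2 * p ^+ 4 = N * p ^+ 2 * q ^+ 2 by rewrite /q; ring.
  move/le_trans; apply; rewrite le_eqVlt; apply/orP; left; apply/eqP.
  by rewrite /q /t; ring.
have u2 : u <= u ^+ 2 by rewrite ler_eXnr.
have q2_ge0 := sqr_ge0 q.
have tq : t * q ^+ 2 <= 4 * u ^+ 2 * q ^+ 2.
  by apply: ler_wpM2r => //; move: m_lt u2; clear; lra.
(* Here [1024 = 16 * 8 ^+ 2], from [t < 4 * u] and [1 / 8 <= q]. *)
have tt : t ^+ 2 <= 1024 * u ^+ 2 * q ^+ 2.
  apply: (@le_trans _ _ ((4 * u) ^+ 2)).
    by apply: lerXn2r (ltW m_lt); rewrite nnegrE // (ltW (le_lt_trans t0 m_lt)).
  have := ler_wpM2l (sqr_ge0 u) q2; rewrite exprMn; clear; lra.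
have uq : 0 < u ^+ 2 * q ^+ 2 by rewrite mulr_gt0 ?exprn_gt0 // (lt_le_trans ltr01).
have := ler_wpM2r q2_ge0 Np.
move: NDp tq tt uq; clear; lra.
Qed.

Lemma exp_bound (R : realType) (x k : R) (m : nat) : 0 < k ->
  0 <= 1 - x -> 2 * ln k <= x * m%:R -> (1 - x) ^+ m <= (k ^+ 2)^-1.
Proof.
move=> k0 x1 xm; apply: (@le_trans _ _ (expR (- x) ^+ m)).
  by apply: lerXn2r; rewrite ?nnegrE ?expR_ge0 ?expR_ge1Dx.
have -> : (k ^+ 2)^-1 = expR (- (2 * ln k)) by rewrite expRN expRM_natl lnK.
by rewrite -expRM_natl ler_expR mulrN lerN2 [m%:R * x]mulrC.
Qed.

(** * Choice of parameters and union bound *)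

Theorem theorem2 (R : realType) (eps delta : R) :
  0 < eps -> 0 < delta -> delta <= 1 ->
  exists k0 : nat, forall (l : R) (n : nat) (f : 'rV['F_2]_n -> R),
    0 <= l -> l <= 1 - eps ->
    (forall x, f x = -1 \/ f x = 1) ->
    folding f delta l ->
    (k0 <= sparsity f)%N ->
    let k : R := (sparsity f)%:R in
    let p : R := 4000 * log2 k / (delta * k `^ ((1 + l) / 2)) in
    1 - 1 / k <=
      sample_parity_prob f p
        [pred A : {set 'rV['F_2]_n} |
           (num_support_cosets f (parity_span A))%:R <= k - delta * k / 6].
Proof.
(* With this [c], the bound [log2 k <= c * s] says exactly that [p <= 1 / 8]. *)
move=> _ d0 d1; pose c : R := delta / 8 / 4000.
have c0 : 0 < c by rewrite !divr_gt0 // ltr0n.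
exists (maxn 3 (Num.truncn ((4 / (c * ln 2)) ^+ 4)).+1).
move=> l n f l0 _ _ fold; rewrite geq_max => /andP[k3 k_ge].
set S := fourier_support f; pose k : R := (sparsity f)%:R.
pose u := log2 k; pose s := k `^ ((1 + l) / 2); pose p := 4000 * u / (delta * s).
have k3R : 3 <= k by rewrite ler_nat.
have k0 : 0 < k by apply: lt_le_trans k3R.
have k1 : 1 <= k by apply: le_trans k3R; rewrite ler1n.
have u1 : 1 <= u by apply: log2_ge1; apply: le_trans k3R; rewrite ler_nat.
have u0 : 0 < u by apply: lt_le_trans u1.
have s0 : 0 < s by apply: powR_gt0.
have p0 : 0 < p by rewrite divr_gt0 // mulr_gt0 // ltr0n.
have p_le : p <= 1 / 8.
  have : u <= c * s.
    apply: log2_le_powR => //; apply: le_trans (ltW (truncnS_gt _)) _.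
    by rewrite ler_nat.
  move=> u_le; rewrite /p ler_pdivrMr ?mulr_gt0 //.
  by move: u_le; rewrite /c; clear; lra.
have p1 : p <= 1 by apply: le_trans p_le _; clear; lra.
have p4 : 0 < 4 * p by rewrite mulr_gt0.
(* The largest degree with [4 * D * p <= 1]. Rounding down costs less than one, so
   [p * D > 1 / 4 - p >= 1 / 8]. *)
pose D := Num.truncn (1 / (4 * p)).
have /andP[D_le D_gt] : D%:R <= 1 / (4 * p) < D.+1%:R.
  by apply: truncn_itv; rewrite divr_ge0 // ltW.
have {}D_le : 4 * D%:R * p <= 1.
  by move: D_le; rewrite (ler_pdivlMr _ _ p4) mulrCA mulrA.
have {}D_gt : 1 / 8 <= p * D%:R.
  by move: D_gt p_le; rewrite (ltr_pdivrMr _ _ p4) -natr1; clear; lra.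
pose C := folding_core f l delta.
have CS : C \subset S by apply/subsetP => x; rewrite inE => /andP[].
have C_ge : delta * k / 3 <= #|C|%:R by apply: card_folding_core.
have /fin_all_exists[F FP] := fun a => sparse_triangle_edges S a D.
have free_le a : a \in C -> subset_prob S p (edge_free (F a)) <= (k ^+ 2)^-1.
  move=> aC; have [FG FD FN] := FP a.
  apply: le_trans (subset_prob_edge_free (ltW p0) p1 D_le _ FD) _.
    move=> e /(subsetP FG) eG; split; first exact: triangle_edges_card eG.
    exact: triangle_edges_sub eG.
  apply: exp_bound => //.
    have := exprn_ile1 2 (ltW p0) p1; clear; lra.
  (* Halved, this gives an exponent of at least [2 * log2 k >= 2 * ln k], hence the failure
     probability [1 / k ^+ 2]. *)
  have : 4 * u <= p ^+ 2 * #|F a|%:R.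
    apply: (@edge_count_bound _ delta s u p #|triangle_pairs S a|%:R _ D%:R) => //.
      move: aC; rewrite inE => /andP[aS a_deg].
      apply: le_trans (card_triangle_pairs_ge l aS).
      apply: (@le_trans _ _ (delta * k / 3 * (2 * k `^ l))); last first.
        by rewrite ler_wpM2r // mulr_ge0 // powR_ge0.
      have -> : s ^+ 2 = k * k `^ l.
        rewrite -powR_mulrn ?powR_ge0 // -powRrM divfK ?pnatr_eq0 //.
        rewrite powRD ?powRr1 ?(ltW k0) //.
        by rewrite (gt_eqF k0) implybT.
      by rewrite le_eqVlt; apply/orP; left; apply/eqP; ring.
    by move: FN; rewrite -(ler_nat R) natrD !natrM -!expr2.
  have := ln_le_log2 k1; rewrite -/u; clear; lra.
pose good (A : {set cube n}) :=
  (num_support_cosets f (parity_span A))%:R <= k - delta * k / 6.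
change (1 - 1 / k <= subset_prob S p good).
(* If every [a] in the core has a sampled edge, twice the number of cosets is at most
   [2 * k - #|C|], and [#|C|] is at least [delta * k / 3]. *)
have bad A : ~~ good A -> [exists a in C, edge_free (F a) A].
  apply: contraNT => /exists_inPn F_hit.
  have := @num_support_cosets_le _ _ f (parity_span A) C CS.
  rewrite -(ler_nat R) natrD !natrM => cosets_le.
  suff /cosets_le : forall a, a \in C ->
      exists y, [/\ y \in S, y != a & a + y \in parity_span A].
    rewrite /good -/k; move: C_ge; clear; lra.
  move=> a /F_hit /forall_inPn[e eF /negPn eA]; have [FG _ _] := FP a.
  exact: triangle_edge_merges (subsetP FG e eF) eA.
have bad_le : subset_prob S p (fun A => ~~ good A) <= 1 / k.
  apply: (@le_trans _ _ (\sum_(a in C) (k ^+ 2)^-1)).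
    have bad_sum := subset_prob_has S (ltW p0) p1 C (fun a => edge_free (F a)).
    apply: le_trans (subset_prob_le S (ltW p0) p1 bad) (le_trans bad_sum _).
    exact: ler_sum.
  rewrite sumr_const -mulr_natl.
  apply: (@le_trans _ _ (k * (k ^+ 2)^-1)).
    by rewrite ler_wpM2r ?invr_ge0 ?sqr_ge0 // ler_nat subset_leq_card.
  by rewrite expr2 invfM mulrA divff ?gt_eqF.
have := subset_probID S p good predT; rewrite subset_prob1.
have -> : subset_prob S p (fun A => good A && predT A) = subset_prob S p good.
  by apply: eq_bigl => A; rewrite andbT.
have -> : subset_prob S p (fun A => ~~ good A && predT A)
        = subset_prob S p (fun A => ~~ good A).
  by apply: eq_bigl => A; rewrite andbT.
move: bad_le; clear; lra.
Qed.
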